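(* Let $a<b$ be real numbers, let $n\ge 1$ be an integer, let $\mathbb{K}=\mathbb{R}$ or $\mathbb{K}=\mathbb{C}$, and let $U_n$ be an $(n+1)$-dimensional subspace of $C^n([a,b],\mathbb{K})$. Let $f_0,f_1\in U_n$ be such that $f_0>0$ on $[a,b]$ and $f_1/f_0$ is (real-valued and) strictly increasing on $[a,b]$. Assume that $U_n$ possesses a non-negative Bernstein basis $p_{n,k}$, $k=0,\dots,n$, and that $$D_{f_0}U_n:=\left\{\frac{d}{dx}\left(\frac{f}{f_0}\right): f\in U_n\right\}$$ possesses a non-negative Bernstein basis $q_{n-1,k}$, $k=0,\dots,n-1$. Let $\beta_{n,k}$ and $\gamma_{n,k}$ ($k=0,\dots,n$) be the coordinates of $f_0$ and $f_1$, i.e. $f_0=\sum_{k=0}^n\beta_{n,k}p_{n,k}$ and $f_1=\sum_{k=0}^n\gamma_{n,k}p_{n,k}$, and suppose that $\beta_{n,k}>0$ for all $k=0,\dots,n$. Then the following three statements are equivalent: a) There exists a generalized Bernstein operator $B_n:C[a,b]\to U_n$ defined by a non-decreasing sequence of nodes $t_{n,0}\le t_{n,1}\le\cdots\le t_{n,n}$, and fixing both $f_0$ and $f_1$ (that is, $B_n f_0=f_0$ and $B_n f_1=f_1$). b) The numbers $\frac{\gamma_{n,k}}{\beta_{n,k}}$, $k=0,\dots,n$, are non-decreasing in $k$. c) The coefficients $w_k$, $k=0,\dots,n-1$, defined by $$\frac{d}{dx}\frac{f_1}{f_0}=\sum_{k=0}^{n-1}w_k\,q_{n-1,k},$$ are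 non-negative. Likewise, the following three statements are equivalent: a') There exists a generalized Bernstein operator $B_n:C[a,b]\to U_n$ defined by a strictly increasing sequence of nodes $t_{n,0}<t_{n,1}<\cdots<t_{n,n}$, and fixing both $f_0$ and $f_1$. b') The numbers $\frac{\gamma_{n,k}}{\beta_{n,k}}$, $k=0,\dots,n$, are strictly increasing in $k$. c') The coefficients $w_k$, $k=0,\dots,n-1$, defined in c), are strictly positive.
   Context: Bernstein basis: for an $(m+1)$-dimensional subspace $V_m$ of $C^m([a,b],\mathbb{K})$ (with $\mathbb{K}=\mathbb{R}$ or $\mathbb{C}$), a Bernstein basis of $V_m$ is a basis $\{v_{m,k}:k=0,\dots,m\}$ such that each $v_{m,k}$ has a zero of order (exactly) $k$ at $a$ and a zero of order (exactly) $m-k$ at $b$; additional zeros in $(a,b)$ are allowed. Here ''zero of order $j$ at $c$'' means that the derivatives of orders $0,\dots,j-1$ vanish at $c$ and the derivative of order $j$ does not. For $U_n$ this is used with $m=n$; for $D_{f_0}U_n$, which is an $n$-dimensional subspace of $C^{n-1}([a,b],\mathbb{K})$, it is used with $m=n-1$. A Bernstein basis is non-negative if $v_{m,k}\ge 0$ on $[a,b]$ for all $k=0,\dots,m$. Generalized Bernstein operator: given a non-negative Bernstein basis $\{p_{n,k}\}_{k=0}^n$ of $U_n$, a generalized Bernstein operator is an operator $B_n:C[a,b]\to U_n$ of the form $$B_n(f)=\sum_{k=0}^n f(t_{n,k})\,\alpha_{n,k}\,p_{n,k},$$ where the nodes $t_{n,0},\dots,t_{n,n}$ belong to $[a,b]$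 and the weights $\alpha_{n,0},\dots,\alpha_{n,n}$ are positive real numbers. In general no ordering of the nodes is required. Here $C[a,b]$ denotes the space of continuous $\mathbb{K}$-valued functions on $[a,b]$. *)

(* Defs.v *)
From HB Require Import structures.
From mathcomp Require Import all_boot all_order all_algebra.
From mathcomp Require Import complex.
From mathcomp Require Import all_classical all_reals all_analysis.

Set Implicit Arguments.
Unset Strict Implicit.
Unset Printing Implicit Defensive.

Import Order.TTheory GRing.Theory Num.Theory.
Import numFieldNormedType.Exports.

Local Open Scope classical_set_scope.
Local Open Scope ring_scope.

Inductive scalars := RealScalars | ComplexScalars.

(* As a numFieldType, R[i] carries the partial order in which z <= w means
   that w - z is a non-negative real.  Hence 0 <= z and 0 < z in
   [field_of R K] mean "z is real and non-negative (positive)" for both K. *)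
Definition field_of (R : realType) (K : scalars) : numFieldType :=
  match K with
  | RealScalars => R : numFieldType
  | ComplexScalars => R[i] : numFieldType
  end.

Definition ofR (R : realType) (K : scalars) : R -> field_of R K :=
  match K return R -> field_of R K with
  | RealScalars => fun x => x
  | ComplexScalars => fun x => x%:C%C
  end.

(* The compact interval as a type, with the topology induced by R: equality of
   functions, limits and continuity are relative to [a, b], so that limits at
   the endpoints are one-sided. *)
Notation seg a b := (set_type `[a, b]%classic).

Definition seg_val (R : realType) (a b : R) (x : seg a b) : R := set_val x.

Notation fun_on R K a b := (seg a b -> field_of R K).

Section Endpoints.
Variables (R : realType) (a b : R) (hab : a < b).

Let left_in : a \in `[a, b]%classic.
Proof. by rewrite inE /= in_itv /= lexx ltW. Qed.

Let right_in : b \in `[a, b]%classic.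
Proof. by rewrite inE /= in_itv /= lexx ltW. Qed.

Definition left_end : seg a b := exist _ a left_in.
Definition right_end : seg a b := exist _ b right_in.
End Endpoints.

Section Functions.
Variables (R : realType) (K : scalars) (a b : R).

Local Notation KK := (field_of R K).
Local Notation fct := (fun_on R K a b).

Definition diff_quotient (f : fct) (x y : seg a b) : KK :=
  (f y - f x) / ofR K (seg_val y - seg_val x).

Definition seg_derivable (f : fct) (x : seg a b) : Prop :=
  cvg (diff_quotient f x y @[y --> x^']).

Definition seg_deriv (f : fct) : fct :=
  fun x => lim (diff_quotient f x y @[y --> x^']).

Definition seg_derivn (j : nat) (f : fct) : fct := iter j seg_deriv f.

Definition class_C (m : nat) (f : fct) : Prop :=
  (forall j, (j < m)%N -> forall x, seg_derivable (seg_derivn j f) x) /\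
  continuous (seg_derivn m f).

Definition zero_of_order (j : nat) (f : fct) (c : seg a b) : Prop :=
  (forall i, (i < j)%N -> seg_derivn i f c = 0) /\ seg_derivn j f c != 0.

Definition is_subspace (V : set fct) : Prop :=
  V 0 /\ forall (c : KK) (f g : fct), V f -> V g -> V (c *: f + g).

Definition is_basis (N : nat) (V : set fct) (v : 'I_N -> fct) : Prop :=
  [/\ forall k, V (v k),
      forall c : 'I_N -> KK, \sum_(k < N) c k *: v k = 0 -> forall k, c k = 0
    & forall f, V f -> exists c : 'I_N -> KK, f = \sum_(k < N) c k *: v k].

Definition has_dim (N : nat) (V : set fct) : Prop :=
  exists v : 'I_N -> fct, is_basis V v.

(* The family is indexed by its length N = m + 1, where m is the largest
   order of a zero. *)
Definition bernstein_basis (hab : a < b) (N : nat) (V : set fct)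
    (v : 'I_N -> fct) : Prop :=
  is_basis V v /\
  forall k : 'I_N, zero_of_order k (v k) (left_end hab) /\
                   zero_of_order (N.-1 - k) (v k) (right_end hab).

Definition nonneg_bernstein_basis (hab : a < b) (N : nat) (V : set fct)
    (v : 'I_N -> fct) : Prop :=
  bernstein_basis hab V v /\ forall k x, 0 <= v k x.

Definition fquot (f g : fct) : fct := fun x => f x / g x.

Definition D_space (f0 : fct) (U : set fct) : set fct :=
  [set seg_deriv (fquot f f0) | f in U].

(* B is only specified on C[a, b]; its values on other functions are
   irrelevant. *)
Definition bernstein_operator (N : nat) (p : 'I_N -> fct) (t : 'I_N -> seg a b)
    (alpha : 'I_N -> R) (B : fct -> fct) : Prop :=
  (forall k, 0 < alpha k) /\
  forall f : fct, continuous f ->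
    B f = \sum_(k < N) (f (t k) * ofR K (alpha k)) *: p k.

End Functions.

(* Main.v *)
Require Import Defs.
From mathcomp Require Import all_boot all_order all_algebra.
From mathcomp Require Import complex zify lra ring.
From mathcomp Require Import all_classical all_reals all_analysis.
Import Order.TTheory GRing.Theory Num.Theory.
Import numFieldNormedType.Exports.
Local Open Scope classical_set_scope.
Local Open Scope ring_scope.

Set Implicit Arguments.
Unset Strict Implicit.
Unset Printing Implicit Defensive.

(* Put r_k = gamma_k / beta_k and let S_k be the sum of beta_j p_j / f0 over
   j > k.  Then S_k vanishes to order k + 1 at a, and 1 - S_k, the sum over
   j <= k, vanishes to order n - k at b.  Hence the derivative of S_k, an
   element of D_{f0} U_n, has no coordinate on q_j for j <> k: it is s_k q_k.
   Since S_k(a) = 0, S_k(b) = 1 and q_k >= 0, the mean value theorem gives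
   s_k > 0.  Summation by parts, f1/f0 = r_0 + sum_k (r_{k+1} - r_k) S_k, then
   yields w_k = (r_{k+1} - r_k) s_k, so b) and c) are equivalent, and
   (f1/f0)(a) = r_0, (f1/f0)(b) = r_n.  Finally, B_n fixes f0 and f1 if and
   only if alpha_k = beta_k / f0(t_k) and (f1/f0)(t_k) = r_k: as f1/f0 is
   strictly increasing, the nodes are ordered like the r_k, and they exist by
   the intermediate value theorem once r_0 <= r_k <= r_n. *)

(** * Real and complex scalars: embedding, real part, limits *)

Section Scalars.
Variables (R : realType) (K : scalars).
Implicit Types (x y : R) (z : field_of R K).

Lemma ofRD x y : ofR K (x + y) = ofR K x + ofR K y.
Proof. by case: K => //=; rewrite rmorphD. Qed.

Lemma ofRN x : ofR K (- x) = - ofR K x.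
Proof. by case: K => //=; rewrite rmorphN. Qed.

Lemma ofRB x y : ofR K (x - y) = ofR K x - ofR K y.
Proof. by rewrite ofRD ofRN. Qed.

Lemma ofR0 : ofR K (0 : R) = 0.
Proof. by case: K. Qed.

Lemma ofR1 : ofR K (1 : R) = 1.
Proof. by case: K. Qed.

Lemma ofRM x y : ofR K (x * y) = ofR K x * ofR K y.
Proof. by case: K => //=; rewrite rmorphM. Qed.

Lemma ofRV x : ofR K x^-1 = (ofR K x)^-1.
Proof. by case: K => //=; rewrite fmorphV. Qed.

Lemma ler_ofR x y : (ofR K x <= ofR K y) = (x <= y).
Proof. by case: K => //=; rewrite lecR. Qed.

Lemma ltr_ofR x y : (ofR K x < ofR K y) = (x < y).
Proof. by case: K => //=; rewrite ltcR. Qed.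

Lemma ofR_inj : injective (@ofR R K).
Proof. by case: K => //= x y []. Qed.

Lemma normr_ofR x : `|ofR K x| = ofR K `|x|.
Proof. by case: K => //=; rewrite normc_def /= expr0n addr0 sqrtr_sqr. Qed.

(** A left inverse of [ofR], through which both choices of [K] are reduced to real analysis. *)
Definition reK : field_of R K -> R :=
  match K return field_of R K -> R with
  | RealScalars => fun u => u
  | ComplexScalars => fun u => complex.Re u
  end.

Lemma ofRK x : reK (ofR K x) = x.
Proof. by rewrite /reK /ofR; case: K. Qed.

Lemma reKB z1 z2 : reK (z1 - z2) = reK z1 - reK z2.
Proof. by move: z1 z2; rewrite /reK; case: K => //= -[? ?] [? ?]. Qed.

Lemma reKZ x z : reK (z * ofR K x) = reK z * x.
Proof.
by move: z; rewrite /reK /ofR; case: K => //= -[? ?] /=; rewrite mulr0 subr0.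
Qed.

Lemma normr_reK z : ofR K `|reK z| <= `|z|.
Proof.
move: z; rewrite /reK /ofR; case: K => //= -[u v] /=.
by rewrite normc_def lecR -sqrtr_sqr ler_wsqrtr //= lerDl sqr_ge0.
Qed.

Lemma reK_real z : z \is Num.real -> ofR K (reK z) = z.
Proof.
move: z; rewrite /reK /ofR; case: K => //= -[u v].
by rewrite complex_real /= => /eqP ->.
Qed.

Lemma reK_cvg (T : Type) (F : set_system T) (FF : Filter F)
    (h : T -> field_of R K) (l : field_of R K) :
  h @ F --> l -> reK \o h @ F --> reK l.
Proof.
move=> hl; apply/cvgrPdist_lt => e e0.
have e0' : 0 < ofR K e by rewrite -ofR0 ltr_ofR.
move/cvgrPdist_lt : hl => /(_ _ e0'); apply: filterS => t ht.
by rewrite -ltr_ofR; apply: le_lt_trans ht; rewrite /= -reKB normr_reK.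
Qed.

Lemma ofR_cvg (T : Type) (F : set_system T) (FF : Filter F) (h : T -> R) l :
  h @ F --> l -> ofR K \o h @ F --> ofR K l.
Proof.
move=> hl; apply/cvgrPdist_lt => e e0.
(* A positive element of [field_of R K] is real, so every tolerance comes from [R]. *)
have e0' : 0 < reK e by rewrite -ltr_ofR ofR0 reK_real// realE ltW.
move/cvgrPdist_lt : hl => /(_ _ e0'); apply: filterS => t ht.
by rewrite /= -ofRB normr_ofR -[e]reK_real ?ltr_ofR// realE ltW.
Qed.

End Scalars.

(** * Topology of the interval and the retraction of the line onto it *)

Section Segment.
Variables (R : realType) (a b : R).
Implicit Types (x y : seg a b).

Lemma seg_valP x : a <= seg_val x <= b.
Proof. by have := set_valP x; rewrite /= in_itv. Qed.

Lemma seg_val_inj : injective (@seg_val R a b).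
Proof. exact: val_inj. Qed.

Lemma nbhs_seg x (A : set (seg a b)) :
  nbhs x A <-> exists2 e : R, 0 < e &
    forall y, `|seg_val x - seg_val y| < e -> A y.
Proof.
split=> [/nbhs_ballP[e /= e0 xA]|[e e0 xA]]; first by exists e.
by apply/nbhs_ballP; exists e.
Qed.

Lemma seg_val_continuous : continuous (@seg_val R a b).
Proof.
move=> x A /nbhs_ballP[e /= e0 xA]; apply/nbhs_seg; exists e => // y xy.
exact: xA.
Qed.

Lemma clamp_subproof (hab : a < b) (r : R) :
  Num.max a (Num.min b r) \in `[a, b]%classic.
Proof.
by rewrite inE /= in_itv /= le_max lexx ge_max ge_min lexx (ltW hab).
Qed.

Definition clamp (hab : a < b) (r : R) : seg a b :=
  exist _ (Num.max a (Num.min b r)) (clamp_subproof hab r).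

Lemma clampE (hab : a < b) (r : R) : a <= r <= b -> seg_val (clamp hab r) = r.
Proof.
move=> /andP[ar rb]; rewrite /clamp /seg_val set_valE/=.
by rewrite (min_idPr rb) (max_idPr ar).
Qed.

Lemma clampK (hab : a < b) x : clamp hab (seg_val x) = x.
Proof. by apply: seg_val_inj; rewrite clampE// seg_valP. Qed.

Lemma clamp_continuous (hab : a < b) : continuous (clamp hab).
Proof.
have ccl : continuous (fun r : R => Num.max a (Num.min b r)).
  move=> r; apply: (@continuous_max _ R (fun=> a) (fun r => Num.min b r)).
    exact: cst_continuous.
  apply: (@continuous_min _ R (fun=> b) id) => //; exact: cst_continuous.
move=> r A /nbhs_seg[e e0 rA].
have /cvgrPdist_lt/(_ _ e0) := ccl r.
by apply: filterS => s /= rs; apply: rA.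
Qed.

(** As [a < b], no point of the interval is isolated; this makes the limits that define derivatives
    unique. *)
Lemma seg_dnbhs_proper (hab : a < b) x : ProperFilter x^'.
Proof.
apply: Build_ProperFilter_ex => A /nbhs_seg[e e0 xA].
have /andP[ax xb] := seg_valP x.
(* A quarter of the length leaves room to move by [d] from [x] towards the farther endpoint. *)
pose d := Num.min (e / 2) ((b - a) / 4).
have d0 : 0 < d by rewrite lt_min !divr_gt0 ?subr_gt0.
have de : d < e.
  by rewrite gt_min ltr_pdivrMr// ltr_pMr// ltr1n.
have db : d <= (b - a) / 4 by rewrite ge_min lexx orbT.
have [y yab xy] : exists2 y, a <= y <= b & `|seg_val x - y| = d.
  have [xm|mx] := leP (seg_val x) ((a + b) / 2).
    exists (seg_val x + d); last by rewrite opprD addNKr normrN gtr0_norm.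
    by apply/andP; split; lra.
  exists (seg_val x - d); last by rewrite opprB addrC subrK gtr0_norm.
  by apply/andP; split; lra.
exists (clamp hab y); apply: xA; first by rewrite clampE// xy.
apply/eqP => yx; move: xy.
by rewrite -yx clampE// subrr normr0 => /eqP; rewrite lt_eqF.
Qed.

End Segment.

(** * Differential calculus on the interval, up to higher order *)

Section Calculus.
Variables (R : realType) (K : scalars) (a b : R) (hab : a < b).
Local Notation KK := (field_of R K).
Local Notation fct := (fun_on R K a b).
Implicit Types (f g : fct) (x : seg a b) (l m c : KK).

Let dnbhs_proper x : ProperFilter x^'.
Proof. exact: seg_dnbhs_proper. Qed.
#[local] Existing Instance dnbhs_proper.

Definition has_deriv f x l := diff_quotient f x y @[y --> x^'] --> l.

Lemma has_deriv_derivable f x l : has_deriv f x l -> seg_derivable f x.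
Proof. by move=> fl; apply/cvg_ex; exists l. Qed.

Lemma has_derivE f x l : has_deriv f x l -> seg_deriv f x = l.
Proof. by move=> fl; apply: cvg_lim fl; exact: norm_hausdorff. Qed.

Lemma ofR_seg_neq0 x y : y != x -> ofR K (seg_val y - seg_val x) != 0.
Proof.
apply: contra_neq => xy; apply: seg_val_inj.
by apply/eqP; rewrite -subr_eq0; apply/eqP/(@ofR_inj _ K); rewrite xy ofR0.
Qed.

Lemma seg_val_cvg x : ofR K (seg_val y - seg_val x) @[y --> x^'] --> (0 : KK).
Proof.
rewrite -(ofR0 R K).
apply: (@ofR_cvg _ _ _ _ _ (fun y => seg_val y - seg_val x)).
rewrite -[X in _ --> X](subrr (seg_val x)); apply: cvgB; last exact: cvg_cst.
by apply/continuous_withinNx; exact: seg_val_continuous.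
Qed.

Lemma has_deriv_cvg f x l : has_deriv f x l -> f y @[y --> x^'] --> f x.
Proof.
move=> fl.
(* For [y != x] this expression is [f y]. *)
have : f x + diff_quotient f x y * ofR K (seg_val y - seg_val x) @[y --> x^']
    --> f x + l * 0.
  by apply: cvgD; [exact: cvg_cst|apply: cvgM fl _; exact: seg_val_cvg].
rewrite mulr0 addr0; apply: cvg_trans; apply: near_eq_cvg.
near=> y.
rewrite /diff_quotient divfK; first by rewrite addrC subrK.
apply: ofR_seg_neq0.
by near: y; exact: withinT.
Unshelve. all: by end_near. Qed.

Lemma has_deriv_continuous f x l : has_deriv f x l -> {for x, continuous f}.
Proof. move=> fl; apply/continuous_withinNx; exact: has_deriv_cvg fl. Qed.

Lemma has_deriv_lin c f g x l m : has_deriv f x l -> has_deriv g x m ->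
  has_deriv (c *: f + g) x (c * l + m).
Proof.
move=> fl gm; rewrite /has_deriv.
have -> : diff_quotient (c *: f + g) x =
    (fun y => c * diff_quotient f x y + diff_quotient g x y).
  apply/funext => y; rewrite /diff_quotient !mulrA -mulrDl; congr (_ / _).
  rewrite -[(c *: f + g) y]/(c * f y + g y) -[(c *: f + g) x]/(c * f x + g x).
  by ring.
by apply: cvgD gm; apply: cvgM fl; exact: cvg_cst.
Qed.

Lemma has_deriv_cst c x : has_deriv (fun=> c) x 0.
Proof.
rewrite /has_deriv.
have -> : diff_quotient (fun=> c) x = (fun=> 0 : KK).
  by apply/funext => y; rewrite /diff_quotient subrr mul0r.
exact: cvg_cst.
Qed.

Lemma has_deriv_mul f g x l m : has_deriv f x l -> has_deriv g x m ->
  has_deriv (fun y => f y * g y) x (l * g x + f x * m).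
Proof.
move=> fl gm; rewrite /has_deriv.
have -> : diff_quotient (fun y => f y * g y) x =
    (fun y => diff_quotient f x y * g y + f x * diff_quotient g x y).
  by apply/funext => y; rewrite /diff_quotient; ring.
apply: cvgD; last by apply: cvgM gm; exact: cvg_cst.
by apply: cvgM fl _; exact: has_deriv_cvg gm.
Qed.

Lemma has_deriv_inv f x l : (forall y, f y != 0) -> has_deriv f x l ->
  has_deriv (fun y => (f y)^-1) x (- l * ((f x)^-1 * (f x)^-1)).
Proof.
move=> f0 fl; rewrite /has_deriv.
have -> : diff_quotient (fun y => (f y)^-1) x =
    (fun y => - diff_quotient f x y * ((f y)^-1 * (f x)^-1)).
  apply/funext => y; rewrite /diff_quotient -mulNr mulrAC; congr (_ / _).
  have := f0 x; have := f0 y; move: (f x) (f y) => u v v0 u0.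
  by rewrite opprB mulrBl mulrCA mulfV// mulr1 mulVKf.
apply: cvgM; first exact: cvgN.
apply: cvgM; last exact: cvg_cst.
by apply: cvgV; [exact: f0|exact: has_deriv_cvg fl].
Qed.


(** The recursion passes to [seg_deriv f], so that closure properties follow by induction on [k]
    with the functions generalized. *)
Fixpoint diffn (k : nat) f : Prop :=
  if k is k'.+1 then (forall x, seg_derivable f x) /\ diffn k' (seg_deriv f)
  else True.

Lemma class_C_diffn k f : class_C k f -> diffn k f.
Proof.
case=> + _; elim: k f => //= k IH f fk; split=> [x|]; first exact: (fk 0%N).
by apply: IH => j jk x; rewrite /seg_derivn -iterSr; exact: (fk j.+1).
Qed.

Lemma diffnS k f : diffn k.+1 f -> diffn k f.
Proof. by elim: k f => //= k IH f [df /IH fk]. Qed.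

Lemma diffn_le j k f : (j <= k)%N -> diffn k f -> diffn j f.
Proof.
by elim: j k f => //= j IH [//|k] f jk [df fk]; split => //; exact: IH fk.
Qed.

Lemma seg_derivnS j f : seg_derivn j.+1 f = seg_derivn j (seg_deriv f).
Proof. exact: iterSr. Qed.

Lemma seg_deriv_lin c f g :
  (forall x, seg_derivable f x) -> (forall x, seg_derivable g x) ->
  seg_deriv (c *: f + g) = c *: seg_deriv f + seg_deriv g.
Proof.
move=> df dg; apply/funext => x; apply: has_derivE.
exact: has_deriv_lin (df x) (dg x).
Qed.

Lemma seg_deriv_cst c : seg_deriv (fun=> c : KK) = 0 :> fct.
Proof. by apply/funext => x; apply: has_derivE; exact: has_deriv_cst. Qed.

Lemma diffn_cst k c : diffn k (fun=> c : KK).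
Proof.
elim: k c => //= k IH c; split; last by rewrite seg_deriv_cst; exact: IH.
by move=> x; apply: has_deriv_derivable; exact: has_deriv_cst.
Qed.

Lemma seg_derivn_cst0 k : seg_derivn k (0 : fct) = 0.
Proof. by elim: k => // k IH; rewrite seg_derivnS seg_deriv_cst. Qed.

Lemma diffn_lin k c f g : diffn k f -> diffn k g -> diffn k (c *: f + g).
Proof.
elim: k f g => //= k IH f g [df fk] [dg gk]; split=> [x|].
  by apply: has_deriv_derivable; exact: has_deriv_lin (df x) (dg x).
by rewrite seg_deriv_lin//; exact: IH.
Qed.

Lemma seg_derivn_lin k c f g : diffn k f -> diffn k g ->
  seg_derivn k (c *: f + g) = c *: seg_derivn k f + seg_derivn k g.
Proof.
elim: k f g => // k IH f g [df fk] [dg gk].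
by rewrite !seg_derivnS seg_deriv_lin//; exact: IH.
Qed.

Lemma diffn_sum k (I : finType) (c : I -> KK) (f : I -> fct) :
  (forall i, diffn k (f i)) -> diffn k (\sum_i c i *: f i).
Proof.
move=> fk; elim/big_ind : _ => [||i _]; first exact: diffn_cst.
  by move=> u v uk vk; rewrite -[u]scale1r; exact: diffn_lin.
by rewrite -[_ *: _]addr0; apply: diffn_lin => //; exact: diffn_cst.
Qed.

Lemma seg_derivn_sum k (I : finType) (c : I -> KK) (f : I -> fct) :
  (forall i, diffn k (f i)) ->
  seg_derivn k (\sum_i c i *: f i) = \sum_i c i *: seg_derivn k (f i).
Proof.
(* Linearity of [seg_derivn] requires differentiability of the partial sums, so the induction
   carries both. *)
move=> fk; pose P u v := diffn k u /\ seg_derivn k u = v.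
suff [] : P (\sum_i c i *: f i) (\sum_i c i *: seg_derivn k (f i)) by [].
elim/big_ind2 : _ => [|u' u v' v [uk <-] [vk <-]|i _]; rewrite /P.
- by split; [exact: diffn_cst|exact: seg_derivn_cst0].
- split; first by rewrite -[u]scale1r; exact: diffn_lin.
  by rewrite -{1}[u]scale1r seg_derivn_lin// scale1r.
- have d0 : diffn k (0 : fct) by exact: diffn_cst.
  rewrite -{1 2}[c i *: f i]addr0; split; first exact: diffn_lin.
  by rewrite seg_derivn_lin// seg_derivn_cst0 addr0.
Qed.

(** The factor 1 gives the right-hand side the shape expected by [diffn_lin] and
    [seg_derivn_lin]. *)
Lemma seg_deriv_mul f g :
  (forall x, seg_derivable f x) -> (forall x, seg_derivable g x) ->
  seg_deriv (fun y => f y * g y) =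
  1 *: (fun y => seg_deriv f y * g y) + (fun y => f y * seg_deriv g y) :> fct.
Proof.
move=> df dg; rewrite scale1r; apply/funext => x; apply: has_derivE.
exact: has_deriv_mul (df x) (dg x).
Qed.

Lemma diffn_mul k f g : diffn k f -> diffn k g -> diffn k (fun y => f y * g y).
Proof.
elim: k f g => //= k IH f g [df fk] [dg gk]; split=> [x|].
  by apply: has_deriv_derivable; exact: has_deriv_mul (df x) (dg x).
by rewrite seg_deriv_mul//; apply: diffn_lin; apply: IH => //; exact: diffnS.
Qed.

(** The derivative of [1/f] is [-f'] times the square of [1/f], a product of functions already known
    to be [k] times derivable. *)
Lemma diffn_inv k f : (forall y, f y != 0) -> diffn k f ->
  diffn k (fun y => (f y)^-1).
Proof.
move=> f0; elim: k => //= k IH [df fk].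
have fVk : diffn k (fun y => (f y)^-1) by apply: IH; exact: diffnS.
split=> [x|].
  by apply: has_deriv_derivable; exact: has_deriv_inv (df x).
have -> : seg_deriv (fun y => (f y)^-1) =
    (fun y => - seg_deriv f y * ((f y)^-1 * (f y)^-1)).
  by apply/funext => x; apply: has_derivE; exact: has_deriv_inv (df x).
apply: diffn_mul; last exact: diffn_mul.
have -> : (fun y => - seg_deriv f y) = -1 *: seg_deriv f + 0.
  by rewrite scaleN1r addr0.
by apply: diffn_lin => //; exact: diffn_cst.
Qed.

(** Induction replaces the Leibniz formula: in [f' g + f g'] both [f'] and [f] have vanishing
    derivatives below the order lowered by one. *)
Lemma seg_derivn_mul_eq0 k f g x : diffn k f -> diffn k g ->
  (forall i, (i < k)%N -> seg_derivn i f x = 0) ->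
  forall i, (i < k)%N -> seg_derivn i (fun y => f y * g y) x = 0.
Proof.
elim: k f g => //= k IH f g [df fk] [dg gk] fx0 [|i] ik.
  by have /= -> := fx0 0%N isT; rewrite mul0r.
have fk' : diffn k f by exact: diffnS.
have gk' : diffn k g by exact: diffnS.
have ik' : (i < k)%N by [].
rewrite seg_derivnS seg_deriv_mul// seg_derivn_lin; last 2 first.
- by apply: diffn_le (ltnW ik') _; exact: diffn_mul.
- by apply: diffn_le (ltnW ik') _; exact: diffn_mul.
rewrite scale1r -[LHS]/(seg_derivn i _ x + seg_derivn i _ x) !IH ?addr0//.
- by move=> j jk; apply: fx0; exact: ltnW.
- by move=> j jk; rewrite -seg_derivnS; apply: fx0.
Qed.

End Calculus.

(** * Mean value and intermediate value theorems for real parts *)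

Section MeanValue.
Variables (R : realType) (K : scalars) (a b : R) (hab : a < b).
Local Notation KK := (field_of R K).
Local Notation fct := (fun_on R K a b).
Implicit Types (f g : fct) (x : seg a b).

Lemma clamp_left : clamp hab a = left_end hab.
Proof. exact: (clampK hab (left_end hab)). Qed.

Lemma clamp_right : clamp hab b = right_end hab.
Proof. exact: (clampK hab (right_end hab)). Qed.

(** Extends the real part of [f] to the whole line, constant beyond each endpoint, so that [MVT] and
    [IVT] apply. *)
Let lift f (r : R) : R := reK (f (clamp hab r)).

Let lift_continuous f : continuous f -> {within `[a, b], continuous (lift f)}.
Proof.
move=> fc; apply: continuous_subspaceT => r.
apply: reK_cvg; apply: continuous_comp; [exact: clamp_continuous|exact: fc].
Qed.

Let lift_derive f (r : R) l : a < r < b -> has_deriv f (clamp hab r) l ->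
  is_derive r 1 (lift f) (reK l).
Proof.
move=> /andP[ar rb] fl; set x := clamp hab r in fl.
have xr : seg_val x = r by rewrite clampE// !ltW.
(* Near the interior point [r] clamping is the identity, so the two difference quotients agree. *)
have hr : \forall h \near (0 : R)^', seg_val (clamp hab (h + r)) = h + r.
  exists (Num.min (r - a) (b - r)); first by rewrite /= lt_min !subr_gt0 ar.
  move=> h; rewrite /ball_ /= sub0r normrN lt_min => /andP[hra hrb] _.
  rewrite clampE//; move: hra hrb; rewrite !ltr_norml => /andP[? ?] /andP[? ?].
  by apply/andP; split; lra.
have clx : clamp hab (h + r) @[h --> 0^'] --> x^'.
  move=> A /nbhs_seg[e e0 xA].
  have he : \forall h \near (0 : R)^', `|h| < e /\ h != 0.
    by exists e => //= h; rewrite /ball_ /= sub0r normrN.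
  apply: filterS2 hr he => h hr [he h0].
  apply: xA; first by rewrite hr xr opprD addrCA subrr addr0 normrN.
  apply: contra_neq h0 => /(congr1 (@seg_val _ _ _)); rewrite hr xr.
  by move=> /eqP; rewrite -subr_eq0 addrK => /eqP.
have dl : h^-1 *: ((lift f \o shift r) (h *: (1 : R)) - lift f r) @[h --> 0^']
    --> reK l.
  have : (@reK R K \o diff_quotient f x) (clamp hab (h + r)) @[h --> 0^']
      --> reK l.
    by apply: cvg_comp clx _; exact: reK_cvg fl.
  apply: cvg_trans; apply: near_eq_cvg; near=> h.
  rewrite /= /diff_quotient xr -ofRV reKZ reKB.
  have -> : seg_val (clamp hab (h + r)) = h + r by near: h.
  by rewrite addrK [h *: 1]mulr1 mulrC.
apply: DeriveDef; first by apply/cvg_ex; exists (reK l).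
exact: cvg_lim dl.
Unshelve. all: by end_near. Qed.

Lemma seg_mvt f f' : (forall x, has_deriv f x (f' x)) ->
  exists x, reK (f (right_end hab)) - reK (f (left_end hab)) =
            reK (f' x) * (b - a).
Proof.
move=> ff'; have fc : continuous f.
  by move=> x; exact: has_deriv_continuous (ff' x).
have [r|c _] := MVT hab _ (lift_continuous fc)
    (df := fun r => reK (f' (clamp hab r))).
  by rewrite in_itv => rab; apply: lift_derive rab _.
by rewrite /lift clamp_left clamp_right => fc'; exists (clamp hab c).
Qed.

Lemma seg_ivt f (v : R) : continuous f ->
  reK (f (left_end hab)) <= v <= reK (f (right_end hab)) ->
  exists x, reK (f x) = v.
Proof.
move=> /lift_continuous fc /andP[va vb].
have [|c _ fcv] := IVT (ltW hab) fc (v := v); last by exists (clamp hab c).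
by rewrite /lift clamp_left clamp_right ge_min le_max va vb orbT.
Qed.

End MeanValue.

(** * Monotonicity of a finite sequence, tested on consecutive terms *)

Lemma ord_steps_le d (T : porderType d) n (r : 'I_n.+1 -> T) :
  (forall i j : 'I_n.+1, (i <= j)%N -> (r i <= r j)%O) <->
  (forall k : 'I_n, (r (inord k) <= r (inord k.+1))%O).
Proof.
split=> [rn k|rn i j].
  by apply: rn; rewrite !inordK ?leqnSn// ltnS// ltnW.
move e : (j : nat) => j'; elim: j' j e => [|j' IH] j jj'.
  rewrite leqn0 => /eqP i0.
  by rewrite (_ : i = j)//; apply: val_inj; rewrite /= i0 jj'.
rewrite leq_eqVlt => /predU1P[ij'|ij'].
  by rewrite (_ : i = j)//; apply: val_inj; rewrite /= ij' jj'.
have j'n : (j' < n)%N by rewrite -ltnS -jj'.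
apply: le_trans (IH (inord j') _ ij') _; first by rewrite inordK// ltnS ltnW.
by have := rn (Ordinal j'n); rewrite /= -jj' inord_val.
Qed.

Lemma ord_steps_lt d (T : porderType d) n (r : 'I_n.+1 -> T) :
  (forall i j : 'I_n.+1, (i < j)%N -> (r i < r j)%O) <->
  (forall k : 'I_n, (r (inord k) < r (inord k.+1))%O).
Proof.
split=> [rn k|rn i j].
  by apply: rn; rewrite !inordK ?ltnSn// ltnS// ltnW.
move e : (j : nat) => j'; elim: j' j e => [//|j' IH] j jj'.
have j'n : (j' < n)%N by rewrite -ltnS -jj'.
have rj : (r (inord j') < r j)%O.
  by have := rn (Ordinal j'n); rewrite /= -jj' inord_val.
rewrite ltnS leq_eqVlt => /predU1P[ij'|ij'].
  by rewrite -ij' inord_val in rj.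
by apply: lt_trans (IH (inord j') _ ij') rj; rewrite inordK// ltnS ltnW.
Qed.

(** * Coordinates in a basis, and their vanishing by counting zeros *)

Section Bases.
Variables (R : realType) (K : scalars) (a b : R).
Local Notation KK := (field_of R K).
Local Notation fct := (fun_on R K a b).
Implicit Types (f g : fct) (x : seg a b).

Lemma sum_scaleE (I : finType) (c : I -> KK) (v : I -> fct) x :
  (\sum_i c i *: v i) x = \sum_i c i * v i x.
Proof. by rewrite fct_sumE. Qed.

Lemma basis_coord N (V : set fct) (v : 'I_N -> fct) (c d : 'I_N -> KK) :
  is_basis V v -> \sum_k c k *: v k = \sum_k d k *: v k -> c =1 d.
Proof.
move=> [_ free _] cd k; apply/eqP; rewrite -subr_eq0; apply/eqP.
apply: (free (fun k => c k - d k)).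
under eq_bigr do rewrite scalerBl.
by rewrite sumrB cd subrr.
Qed.

Lemma subspace_sum (I : finType) (V : set fct) (c : I -> KK) (v : I -> fct) :
  is_subspace V -> (forall i, V (v i)) -> V (\sum_i c i *: v i).
Proof.
move=> [V0 Vlin] Vv; elim/big_ind : _ => // [f g Vf Vg|i _].
  by rewrite -[f]scale1r; exact: Vlin.
by rewrite -[_ *: _]addr0; exact: Vlin.
Qed.

Lemma fquot_sum (I : finType) (c : I -> KK) (v : I -> fct) g :
  fquot (\sum_i c i *: v i) g = \sum_i c i *: fquot (v i) g.
Proof.
apply/funext => x; rewrite /fquot !sum_scaleE mulr_suml.
by apply: eq_bigr => i _; rewrite mulrA.
Qed.

Variable hab : a < b.

(** A triangular system: in the derivative of order [ord i] at [x], terms of larger order vanish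
    there and those of smaller order have zero coefficient by induction. A general [ord] serves both
    endpoints. *)
Lemma coord_eq0_of_zero (I : finType) (m : nat) (ord : I -> nat) (c : I -> KK)
    (v : I -> fct) x :
  (forall i, diffn m (v i)) -> injective ord ->
  (forall i, zero_of_order (ord i) (v i) x) ->
  (forall j, (j < m)%N -> seg_derivn j (\sum_i c i *: v i) x = 0) ->
  forall i, (ord i < m)%N -> c i = 0.
Proof.
move=> vm ordI v0 s0 i; move e : (ord i) => k.
elim/ltn_ind : k i e => k IH i ik km.
have := s0 _ km; rewrite seg_derivn_sum//; last first.
  by move=> j; exact: diffn_le (ltnW km) (vm j).
rewrite sum_scaleE (bigD1 i)//= big1 => [|j ji].
  rewrite addr0 => /eqP; rewrite mulf_eq0 -ik; case: (v0 i) => _ /negPf ->.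
  by rewrite orbF => /eqP.
have [jk|kj|jk] := ssrnat.ltngtP (ord j) k.
- by rewrite (IH _ jk)// ?mul0r// (ltn_trans jk).
- by have [/(_ _ kj) -> _] := v0 j; rewrite mulr0.
- by move: ji; rewrite -(inj_eq ordI) jk ik eqxx.
Qed.

(** The difference quotients equal their embedded real parts, so uniqueness of limits gives
    [l = ofR K (reK l)]. *)
Lemma has_deriv_real f x (l : KK) : (forall y, f y \is Num.real) ->
  has_deriv f x l -> l \is Num.real.
Proof.
move=> fr fl; have xP := seg_dnbhs_proper hab x.
suff -> : l = ofR K (reK l).
  by rewrite realE -(ofR0 R K) !ler_ofR -realE num_real.
apply: (cvg_unique _ fl); first exact: norm_hausdorff.
have : (@ofR R K \o (@reK R K \o diff_quotient f x)) @ x^' --> ofR K (reK l).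
  by apply: ofR_cvg; exact: reK_cvg fl.
apply: cvg_trans; apply: near_eq_cvg.
apply: nearW => y /=; rewrite /diff_quotient -ofRV reKZ reKB ofRM ofRB.
by rewrite !reK_real.
Qed.

End Bases.

(** * Tails, ratios and nodes for the two Bernstein bases, with n = m + 1 *)

Section Bernstein.
Variables (R : realType) (K : scalars) (a b : R) (hab : a < b) (m : nat).
Local Notation KK := (field_of R K).
Local Notation fct := (fun_on R K a b).
Variables (U : set fct) (f0 f1 : fct) (p : 'I_m.+2 -> fct) (q : 'I_m.+1 -> fct).
Variables (beta gamma : 'I_m.+2 -> KK) (w : 'I_m.+1 -> KK).
Variables (hUsub : is_subspace U) (hUC : forall f, U f -> class_C m.+1 f).
Variables (hf0U : U f0) (hf1U : U f1) (hf0 : forall x, 0 < f0 x).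
Variables (hp : nonneg_bernstein_basis hab U p).
Variables (hq : nonneg_bernstein_basis hab (D_space f0 U) q).
Variables (hbeta : f0 = \sum_(k < m.+2) beta k *: p k).
Variables (hgamma : f1 = \sum_(k < m.+2) gamma k *: p k).
Variables (hbeta0 : forall k, 0 < beta k).
Variables (hw : seg_deriv (fquot f1 f0) = \sum_(k < m.+1) w k *: q k).

Let phi j := fquot (p j) f0.
(** Indexed by [nat] so that [r k.+1 - r k] makes sense for [k : 'I_m.+1]; [inord] is exact up to
    [m.+1]. *)
Let r (i : nat) : KK := gamma (inord i) / beta (inord i).

Lemma denom_neq0 x : f0 x != 0.
Proof. by rewrite lt0r_neq0. Qed.

Lemma space_diffn f : U f -> diffn m.+1 f.
Proof. by move=> /hUC/class_C_diffn. Qed.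

Lemma fquot_diffn f : U f -> diffn m.+1 (fquot f f0).
Proof.
move=> fU; apply: diffn_mul => //; first exact: space_diffn.
by apply: diffn_inv => //; [exact: denom_neq0|exact: space_diffn].
Qed.

Lemma basisU j : U (p j).
Proof. by case: hp => -[[]]. Qed.

Lemma dbasis_diffn k : diffn m (q k).
Proof.
by case: hq => -[[/(_ k)[f fU <-]] _ _ _ _]; case: (fquot_diffn fU).
Qed.

Lemma fquot_zero x f k i : U f -> (k <= m.+1)%N ->
  (forall i, (i < k)%N -> seg_derivn i f x = 0) -> (i < k)%N ->
  seg_derivn i (fquot f f0) x = 0.
Proof.
move=> fU km fx ik; apply: (seg_derivn_mul_eq0 hab _ _ fx ik).
  exact: diffn_le km (space_diffn fU).
apply: diffn_inv => //; first exact: denom_neq0.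
exact: diffn_le km (space_diffn hf0U).
Qed.

Lemma phi_left (j : 'I_m.+2) i : (i < j)%N ->
  seg_derivn i (phi j) (left_end hab) = 0.
Proof.
apply: fquot_zero; [exact: basisU|by rewrite -ltnS|].
by case: hp => -[_ /(_ j)[[]]].
Qed.

Lemma phi_right (j : 'I_m.+2) i : (i < m.+1 - j)%N ->
  seg_derivn i (phi j) (right_end hab) = 0.
Proof.
apply: fquot_zero; [exact: basisU|exact: leq_subr|].
by case: hp => -[_ /(_ j)[_ []]].
Qed.

Lemma phi_diffn j : diffn m.+1 (phi j).
Proof. exact: fquot_diffn (basisU j). Qed.

Lemma sum_beta_phi : \sum_j beta j *: phi j = (fun=> 1).
Proof.
rewrite -fquot_sum -hbeta; apply/funext => x.
by rewrite /fquot divff// denom_neq0.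
Qed.

(** The function S_k of the overview, as a sum over all indices with zero coefficients, to which the
    lemmas on linear combinations apply. *)
Let tail (k : 'I_m.+1) :=
  \sum_(j < m.+2) (if (k < j)%N then beta j else 0) *: phi j.

(** At [a] the tail itself has a high-order zero; at [b] it is the complementary sum that does, and
    this form exposes it. *)
Lemma tailE k :
  tail k =
    -1 *: (\sum_(j < m.+2) (if (k < j)%N then 0 else beta j) *: phi j) + (fun=> 1).
Proof.
rewrite -sum_beta_phi scaleN1r addrC -sumrB; apply: eq_bigr => j _.
by rewrite -scalerBl; case: ifP; rewrite ?subr0 ?subrr.
Qed.

Lemma tail_diffn k : diffn m.+1 (tail k).
Proof. by apply: diffn_sum => // j; exact: phi_diffn. Qed.

Lemma tail_left (k : 'I_m.+1) i : (i <= k)%N ->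
  seg_derivn i (tail k) (left_end hab) = 0.
Proof.
move=> ik; have im : (i <= m.+1)%N by rewrite (leq_trans ik)// ltnW.
rewrite seg_derivn_sum//; last by move=> j; exact: diffn_le im (phi_diffn j).
rewrite sum_scaleE big1// => j _; case: ifP => kj; last by rewrite mul0r.
by rewrite phi_left ?mulr0// (leq_ltn_trans ik).
Qed.

Let head_right (k : 'I_m.+1) i : (i <= m - k)%N ->
  seg_derivn i (\sum_(j < m.+2) (if (k < j)%N then 0 else beta j) *: phi j)
    (right_end hab) = 0.
Proof.
move=> ik; have im : (i <= m.+1)%N.
  by rewrite (leq_trans ik)// (leq_trans (leq_subr _ _)).
rewrite seg_derivn_sum//; last by move=> j; exact: diffn_le im (phi_diffn j).
(* For [j <= k], [phi j] vanishes at [b] through order [m - j], which is at least [m - k]. *)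
rewrite sum_scaleE big1// => j _; case: ltnP => kj; first by rewrite mul0r.
by rewrite phi_right ?mulr0//; have := ltn_ord k; lia.
Qed.

Lemma tail_right (k : 'I_m.+1) i : (i < m - k)%N ->
  seg_derivn i.+1 (tail k) (right_end hab) = 0.
Proof.
move=> ik; have im : (i < m.+1)%N.
  by rewrite (leq_trans ik)// (leq_trans (leq_subr _ _)).
rewrite tailE seg_derivn_lin//.
- rewrite -[LHS]/(-1 * _ + _) head_right// mulr0 add0r.
  by rewrite seg_derivnS seg_deriv_cst// seg_derivn_cst0.
- by apply: diffn_sum => // j; exact: diffn_le im (phi_diffn j).
- exact: diffn_cst.
Qed.

Lemma tail_right1 k : tail k (right_end hab) = 1.
Proof.
rewrite tailE -[LHS]/(-1 * _ + 1).
by have /= -> := head_right (leq0n (m - k)); rewrite mulr0 add0r.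
Qed.

Lemma tail_real k x : tail k x \is Num.real.
Proof.
rewrite ger0_real// /tail sum_scaleE sumr_ge0// => j _.
have ? : 0 <= phi j x by rewrite divr_ge0//; [case: hp|rewrite ltW].
by case: ifP => _; rewrite mulr_ge0// ltW.
Qed.

(* Order counting at a kills the coordinates below k, at b those above k. *)
Lemma tail_deriv k : exists2 s : KK, 0 < s & seg_deriv (tail k) = s *: q k.
Proof.
have dS x : has_deriv (tail k) x (seg_deriv (tail k) x).
  by have [dS _] := tail_diffn k; exact: dS.
have DS : D_space f0 U (seg_deriv (tail k)).
  exists (\sum_(j < m.+2) (if (k < j)%N then beta j else 0) *: p j).
    by apply: subspace_sum => // j; exact: basisU.
  by rewrite fquot_sum.
have [[[_ _ /(_ _ DS)[d Sd]] q0] qge0] := hq.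
have km : (k <= m)%N by rewrite -ltnS.
have dl : forall i : 'I_m.+1, (i < k)%N -> d i = 0.
  apply: (@coord_eq0_of_zero _ _ _ _ hab _ k _ _ q (left_end hab)).
  - by move=> i; exact: diffn_le km (dbasis_diffn i).
  - exact: val_inj.
  - by move=> i; case: (q0 i).
  - by move=> j jk; rewrite -Sd -seg_derivnS tail_left.
have dr : forall i : 'I_m.+1, (m - i < m - k)%N -> d i = 0.
  (* At [b] the zero of [q i] has order [m - i], so coordinates are eliminated from the last index
     downwards. *)
  apply: (@coord_eq0_of_zero _ _ _ _ hab _ (m - k)%N
    (fun i : 'I_m.+1 => m - i)%N d q (right_end hab)).
  - by move=> i; exact: diffn_le (leq_subr _ _) (dbasis_diffn i).
  - move=> i j ij; apply: val_inj.
    by have := ltn_ord i; have := ltn_ord j; move: ij => /=; lia.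
  - by move=> i; case: (q0 i).
  - by move=> j jk; rewrite -Sd -seg_derivnS tail_right.
have {}Sd : seg_deriv (tail k) = d k *: q k.
  rewrite Sd (bigD1 k)//= big1 ?addr0// => i ik.
  have [lt_ik|lt_ki|/val_inj eik] := ssrnat.ltngtP i k.
  - by rewrite dl// scale0r.
  - by rewrite dr ?scale0r//; have := ltn_ord i; lia.
  - by rewrite eik eqxx in ik.
exists (d k) => //.
have [c c1] := seg_mvt hab dS.
have {}c1 : 1 = reK (seg_deriv (tail k) c) * (b - a).
  rewrite -c1 tail_right1; have /= -> := tail_left (leq0n k).
  by rewrite -(ofR1 R K) -(ofR0 R K) !ofRK subr0.
(* The mean value theorem controls only the real part; since [tail k] is real, so is its derivative,
   and positivity holds in [field_of R K]. *)
have Sc : 0 < seg_deriv (tail k) c.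
  rewrite -(reK_real (has_deriv_real hab (tail_real k) (dS c))) -(ofR0 R K).
  by rewrite ltr_ofR -(pmulr_lgt0 _ (_ : 0 < b - a)) -?c1 ?subr_gt0.
have {}Sc : 0 < d k * q k c by move: Sc; rewrite Sd.
have qc : 0 < q k c.
  rewrite lt0r qge0 andbT; apply: contraTneq Sc => ->.
  by rewrite mulr0 ltxx.
by move: Sc; rewrite pmulr_lgt0.
Qed.

(** A telescoping sum, with the range [k < j] moved into a condition so that the sums over [k] and
    [j] can be exchanged. *)
Let r_tail (j : 'I_m.+2) :
  r j = r 0 + \sum_(k < m.+1) (if (k < j)%N then r k.+1 - r k else 0).
Proof.
rewrite -big_mkcond /= -(big_ord_widen _ (fun k => r k.+1 - r k)) -1?ltnS//.
rewrite -(big_mkord xpredT (fun k => r k.+1 - r k)).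
by rewrite telescope_sumr// addrC subrK.
Qed.

Let rE (j : 'I_m.+2) : gamma j / beta j = r j.
Proof. by rewrite /r inord_val. Qed.

Lemma fquot_tails :
  fquot f1 f0 = 1 *: (\sum_(k < m.+1) (r k.+1 - r k) *: tail k) + (fun=> r 0).
Proof.
rewrite scale1r hgamma fquot_sum; apply/funext => x.
rewrite -[RHS]/((\sum_(k < m.+1) (r k.+1 - r k) *: tail k) x + r 0) !sum_scaleE.
have e1 : \sum_j beta j * phi j x = 1 by rewrite -sum_scaleE sum_beta_phi.
transitivity (\sum_(j < m.+2) r j * (beta j * phi j x)).
  apply: eq_bigr => j _.
  by rewrite mulrA -rE divfK// lt0r_neq0.
under eq_bigr do rewrite r_tail mulrDl.
rewrite big_split/= -mulr_sumr e1 mulr1 addrC; congr (_ + _).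
under eq_bigr do rewrite mulr_suml.
rewrite exchange_big; apply: eq_bigr => k _ /=.
rewrite /tail sum_scaleE mulr_sumr; apply: eq_bigr => j _.
by case: ifP => _; rewrite ?mul0r ?mulr0.
Qed.

Lemma fquot_left : fquot f1 f0 (left_end hab) = gamma ord0 / beta ord0.
Proof.
rewrite fquot_tails rE -[LHS]/(1 * _ + r 0) sum_scaleE.
rewrite big1 ?mulr0 ?add0r// => k _.
by have /= -> := tail_left (leq0n k); rewrite mulr0.
Qed.

Lemma fquot_right : fquot f1 f0 (right_end hab) = gamma ord_max / beta ord_max.
Proof.
rewrite fquot_tails rE r_tail -[LHS]/(1 * _ + r 0) sum_scaleE mul1r addrC.
congr (_ + _); apply: eq_bigr => k _.
(* Every tail is 1 at [b], and for [j = ord_max] every condition [k < j] of [r_tail] holds. *)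
by rewrite tail_right1 mulr1 /= ltn_ord.
Qed.

(** Differentiating [fquot_tails] turns each tail into a positive multiple of [q k]; coordinates are
    then compared. Positive factors transfer both weak and strict signs. *)
Lemma coord_deriv : exists s : 'I_m.+1 -> KK, (forall k, 0 < s k) /\
  forall k, w k = (r k.+1 - r k) * s k.
Proof.
have /choice[s sP] : forall k, exists s : KK,
    0 < s /\ seg_deriv (tail k) = s *: q k.
  by move=> k; have [s s0 Ss] := tail_deriv k; exists s.
exists s; split=> [k|]; first by case: (sP k).
have dS k : diffn 1 (tail k) by exact: diffn_le (tail_diffn k).
have dsum : diffn 1 (\sum_(k < m.+1) (r k.+1 - r k) *: tail k).
  exact: diffn_sum.
have [[qbasis _] _] := hq; apply: (basis_coord qbasis).
rewrite -hw fquot_tails seg_deriv_lin//; last 2 first.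
- by case: dsum.
- by have [] : diffn 1 ((fun=> r 0) : fct) by exact: diffn_cst.
rewrite seg_deriv_cst// addr0 scale1r -[LHS]/(seg_derivn 1 _) seg_derivn_sum//.
by apply: eq_bigr => k _; case: (sP k) => _ /= ->; rewrite scalerA.
Qed.

Lemma ratio_le_deriv :
  (forall i j : 'I_m.+2, (i <= j)%N -> gamma i / beta i <= gamma j / beta j) <->
  (forall k, 0 <= w k).
Proof.
have [s [s0 ws]] := coord_deriv.
rewrite (ord_steps_le (fun i => gamma i / beta i)).
by split=> rw k; move: (rw k); rewrite ws pmulr_lge0// subr_ge0.
Qed.

Lemma ratio_lt_deriv :
  (forall i j : 'I_m.+2, (i < j)%N -> gamma i / beta i < gamma j / beta j) <->
  (forall k, 0 < w k).
Proof.
have [s [s0 ws]] := coord_deriv.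
rewrite (ord_steps_lt (fun i => gamma i / beta i)).
by split=> rw k; move: (rw k); rewrite ws pmulr_lgt0// subr_gt0.
Qed.

Lemma diffn_continuous (f : fct) : diffn m.+1 f -> continuous f.
Proof. by case=> df _ x; exact: has_deriv_continuous (df x). Qed.

(** Comparing coordinates in [p] gives [beta k] and [gamma k] as values at [t k] times the same
    weight, which cancels in the ratio. *)
Lemma fixing_nodes t alpha B : bernstein_operator p t alpha B ->
  B f0 = f0 -> B f1 = f1 -> forall k, gamma k / beta k = fquot f1 f0 (t k).
Proof.
move=> [alpha0 Bdef] Bf0 Bf1 k; have [[pbasis _] _] := hp.
have bk : f0 (t k) * ofR K (alpha k) = beta k.
  apply: (basis_coord (c := fun k => f0 (t k) * ofR K (alpha k)) pbasis).
  by rewrite -hbeta -Bdef//; apply: diffn_continuous; exact: space_diffn.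
have gk : f1 (t k) * ofR K (alpha k) = gamma k.
  apply: (basis_coord (c := fun k => f1 (t k) * ofR K (alpha k)) pbasis).
  by rewrite -hgamma -Bdef//; apply: diffn_continuous; exact: space_diffn.
have a0 : ofR K (alpha k) != 0 by rewrite gt_eqF// -(ofR0 R K) ltr_ofR.
by rewrite -bk -gk invfM mulrACA divff// mulr1.
Qed.

Lemma exists_fixing_operator :
  (forall k, exists x, fquot f1 f0 x = gamma k / beta k) ->
  exists t alpha B, [/\ bernstein_operator p t alpha B,
    forall k, fquot f1 f0 (t k) = gamma k / beta k, B f0 = f0 & B f1 = f1].
Proof.
(* Fixing [f0] forces this weight; the quotient is positive, hence real, and [reK] loses nothing. *)
move=> /choice[t tP]; pose alpha k := reK (beta k / f0 (t k)).
have alphaE k : ofR K (alpha k) = beta k / f0 (t k).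
  by rewrite reK_real// gtr0_real// divr_gt0.
exists t, alpha, (fun f => \sum_(k < m.+2) (f (t k) * ofR K (alpha k)) *: p k).
split=> //.
- split=> // k; rewrite -(ltr_ofR K) ofR0 alphaE divr_gt0//.
- rewrite [RHS]hbeta; apply: eq_bigr => k _.
  by rewrite alphaE mulrC divfK// denom_neq0.
- rewrite [RHS]hgamma; apply: eq_bigr => k _; congr (_ *: _).
  rewrite alphaE mulrCA -/(fquot f1 f0 (t k)) tP mulrC divfK//.
  by rewrite lt0r_neq0.
Qed.

Lemma fquot_attains v :
  fquot f1 f0 (left_end hab) <= v <= fquot f1 f0 (right_end hab) ->
  (forall x, fquot f1 f0 x \is Num.real) -> exists x, fquot f1 f0 x = v.
Proof.
move=> /andP[lv vr] freal.
(* An element comparable to a real one is real, so [v] is determined by its real part. *)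
have vreal : v \is Num.real.
  rewrite -(subrK (fquot f1 f0 (left_end hab)) v).
  by rewrite realD// ger0_real// subr_ge0.
have [|x xv] := seg_ivt (hab := hab) (f := fquot f1 f0) (v := reK v)
    (diffn_continuous (fquot_diffn hf1U)).
  by rewrite -!(ler_ofR K) !reK_real// lv.
by exists x; rewrite -[LHS]reK_real// xv reK_real.
Qed.

End Bernstein.

(** * The two chains of equivalences *)

Theorem theorem3p3 (R : realType) (K : scalars) (a b : R) (hab : a < b)
  (n : nat) (hn : (1 <= n)%N)
  (U : set (fun_on R K a b))
  (hUsub : is_subspace U) (hUdim : has_dim n.+1 U)
  (hUC : forall f, U f -> class_C n f)
  (f0 f1 : fun_on R K a b) (hf0U : U f0) (hf1U : U f1)
  (hf0 : forall x, 0 < f0 x)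
  (hreal : forall x, fquot f1 f0 x \is Num.real)
  (hincr : forall x y, seg_val x < seg_val y -> fquot f1 f0 x < fquot f1 f0 y)
  (p : 'I_n.+1 -> fun_on R K a b)
  (hp : nonneg_bernstein_basis hab U p)
  (q : 'I_n -> fun_on R K a b)
  (hq : nonneg_bernstein_basis hab (D_space f0 U) q)
  (beta gamma : 'I_n.+1 -> field_of R K)
  (hbeta : f0 = \sum_(k < n.+1) beta k *: p k)
  (hgamma : f1 = \sum_(k < n.+1) gamma k *: p k)
  (hbeta0 : forall k, 0 < beta k)
  (w : 'I_n -> field_of R K)
  (hw : seg_deriv (fquot f1 f0) = \sum_(k < n) w k *: q k) :
  (((exists (t : 'I_n.+1 -> seg a b) (alpha : 'I_n.+1 -> R)
            (B : fun_on R K a b -> fun_on R K a b),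
       [/\ bernstein_operator p t alpha B,
           forall i j : 'I_n.+1, (i <= j)%N -> seg_val (t i) <= seg_val (t j),
           B f0 = f0 & B f1 = f1])
    <-> (forall i j : 'I_n.+1,
           (i <= j)%N -> gamma i / beta i <= gamma j / beta j))
   /\
   ((forall i j : 'I_n.+1, (i <= j)%N -> gamma i / beta i <= gamma j / beta j)
    <-> (forall k : 'I_n, 0 <= w k)))
  /\
  (((exists (t : 'I_n.+1 -> seg a b) (alpha : 'I_n.+1 -> R)
            (B : fun_on R K a b -> fun_on R K a b),
       [/\ bernstein_operator p t alpha B,
           forall i j : 'I_n.+1, (i < j)%N -> seg_val (t i) < seg_val (t j),
           B f0 = f0 & B f1 = f1])
    <-> (forall i j : 'I_n.+1,
           (i < j)%N -> gamma i / beta i < gamma j / beta j))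
   /\
   ((forall i j : 'I_n.+1, (i < j)%N -> gamma i / beta i < gamma j / beta j)
    <-> (forall k : 'I_n, 0 < w k))).
Proof.
move: n hn hUdim hUC p hp q hq beta gamma hbeta hgamma hbeta0 w hw.
case=> [//|m] _ _ hUC p hp q hq beta gamma hbeta hgamma hbeta0 w hw.
have fixing := fixing_nodes hUC hf0U hf1U hp hbeta hgamma.
have operator := exists_fixing_operator hf0 hbeta hgamma hbeta0.
(* The order on [field_of R K] may be partial, so the case split is made on the points, which are
   totally ordered. *)
have le_node (x y : seg a b) :
    (seg_val x <= seg_val y) = (fquot f1 f0 x <= fquot f1 f0 y).
  have [xy|yx|/seg_val_inj ->] := ltgtP; last by rewrite lexx.
    by rewrite ltW// hincr.
  by rewrite lt_geF// hincr.
have lt_node (x y : seg a b) :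
    (seg_val x < seg_val y) = (fquot f1 f0 x < fquot f1 f0 y).
  have [xy|yx|/seg_val_inj ->] := ltgtP; last by rewrite ltxx.
    by rewrite hincr.
  by rewrite lt_gtF// hincr.
(* Monotone ratios lie between the first and the last, which are the endpoint values of [f1/f0]. *)
have attain : (forall i j : 'I_m.+2, (i <= j)%N ->
    gamma i / beta i <= gamma j / beta j) ->
    forall k, exists x, fquot f1 f0 x = gamma k / beta k.
  move=> ratio k; apply: (fquot_attains (hab := hab) hUC hf0U hf1U hf0) => //.
  rewrite (fquot_left hUC hf0U hf0 hp hbeta hgamma hbeta0).
  rewrite (fquot_right hUC hf0U hf0 hp hbeta hgamma hbeta0).
  by rewrite !ratio// -ltnS.
split; split.
- split=> [[t [alpha [B [Bop tinc Bf0 Bf1]]]] i j ij|ratio].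
    by rewrite !(fixing _ _ _ Bop Bf0 Bf1) -le_node tinc.
  have [t [alpha [B [Bop tP Bf0 Bf1]]]] := operator (attain ratio).
  by exists t, alpha, B; split=> // i j ij; rewrite le_node !tP ratio.
- exact: ratio_le_deriv hUsub hUC hf0U hf0 hp hq hbeta hgamma hbeta0 hw.
- split=> [[t [alpha [B [Bop tinc Bf0 Bf1]]]] i j ij|ratio].
    by rewrite !(fixing _ _ _ Bop Bf0 Bf1) -lt_node tinc.
  (* The weak form suffices to obtain the nodes; [lt_node] then orders them strictly. *)
  have ratio_le (i j : 'I_m.+2) : (i <= j)%N ->
      gamma i / beta i <= gamma j / beta j.
    by rewrite leq_eqVlt => /predU1P[/val_inj ->//|/ratio/ltW].
  have [t [alpha [B [Bop tP Bf0 Bf1]]]] := operator (attain ratio_le).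
  by exists t, alpha, B; split=> // i j ij; rewrite lt_node !tP ratio.
- exact: ratio_lt_deriv hUsub hUC hf0U hf0 hp hq hbeta hgamma hbeta0 hw.
Qed.
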